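(* Consider any Sturm icosahedron $\mathbb{I}$, i.e. any 3-cell template whose underlying cell complex is the solid icosahedron. Then the poles $\mathbf{N},\mathbf{S}$ are (edge) neighbors, and the face count $\eta$ of the smaller (Western) hemisphere is at most 2. For $\eta=2$, the poles are located at the endpoints of the unique shared, non-meridian edge of the two Western triangle faces.
   Context: A finite regular CW-complex $\mathcal{C}=\bigcup_{v\in\mathcal{E}}c_v$ is a finite disjoint union of open cells $c_v$, labeled by barycenters $v\in\mathcal{E}$, whose characteristic maps $\overline{B}_v\to\overline{c}_v$ are homeomorphisms (including on the boundary) and such that each boundary $\partial c_v$ is a subcomplex of the skeleton of lower dimension. Cells of dimension 0, 1, 2 are called vertices, edges, faces. A bipolar orientation of the 1-skeleton is an orientation of all edges without directed cycles and with exactly one ''source'' vertex $\mathbf{N}$ (North pole) and exactly one ''sink'' vertex $\mathbf{S}$ (South pole). A finite regular cell complex $\mathcal{C}$ is called a 3-cell template if all of the following hold. (i) $\mathcal{C}=\mathrm{clos}\,c_{\mathcal{O}}=S^2\,\dot\cup\,c_{\mathcal{O}}$ is the closure of a single 3-cell $c_{\mathcal{O}}$. (ii) The 1-skeleton $\mathcal{C}^1$ carries a bipolar orientation from a pole vertex $\mathbf{N}$ to a pole vertex $\mathbf{S}$, with two directed meridian paths $\mathbf{WE}$ and $\mathbf{EW}$ from $\mathbf{N}$ to $\mathbf{S}$, disjoint except for the poles. The meridians decompose the boundary sphere $S^2=\partial c_{\mathcal{O}}$ into two remaining (open) hemisphere components $\mathbf{W}$ (West) and $\mathbf{E}$ (East).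 (iii) At end points on the meridians other than the poles $\mathbf{N},\mathbf{S}$, edges in $\mathbf{W}$ are directed towards the meridians and edges in $\mathbf{E}$ are directed away from the meridians. (iv) Let $\mathbf{NE}$ be the unique face in $\mathbf{W}$ containing the first edge of $\mathbf{WE}$ in its boundary, and $\mathbf{SW}$ the unique face in $\mathbf{E}$ containing the last edge of $\mathbf{WE}$ in its boundary. Then the boundaries of $\mathbf{NE}$ and $\mathbf{SW}$ share at least one edge of $\mathbf{WE}$. Similarly, let $\mathbf{NW}$ be the unique face in $\mathbf{W}$ adjacent to the first edge of $\mathbf{EW}$, and $\mathbf{SE}$ the unique face in $\mathbf{E}$ adjacent to the last edge of $\mathbf{EW}$. Then their boundaries share at least one edge of $\mathbf{EW}$. The solid icosahedron is the regular cell complex of a 3-cell whose boundary sphere complex is the boundary complex of the convex regular icosahedron (12 vertices, 30 edges, 20 triangular faces). The number $\eta$ is the number of faces in the hemisphere with fewer faces; the convention is that this is the Western hemisphere $\mathbf{W}$, which is no loss of generality by the trivial equivalence $\kappa$ that reverses all edge orientations and interchanges $\mathbf{N}\leftrightarrow\mathbf{S}$, $\mathbf{WE}\leftrightarrow\mathbf{EW}$, $\mathbf{W}\leftrightarrow\mathbf{E}$. Meridian edges are the edges of the paths $\mathbf{WE}$ and $\mathbf{EW}$. Background: by earlier work of the same authors, 3-cell templates are exactly the Thom-Smale complexes (decompositions into unstable manifolds of equilibria, with signed hemisphere decomposition) of Sturm 3-ball global attractors of dissipative PDEs $u_t=u_{xx}+f(x,u,u_x)$ on $0<x<1$ with Neumann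 boundary conditions and hyperbolic equilibria. *)

(* Defs.v *)
From HB Require Import structures.
From mathcomp Require Import all_boot all_order all_algebra.
From mathcomp Require Import all_classical all_reals all_analysis.

Set Implicit Arguments.
Unset Strict Implicit.
Unset Printing Implicit Defensive.

Import Order.TTheory GRing.Theory Num.Theory.
Import numFieldNormedType.Exports.

Local Open Scope classical_set_scope.
Local Open Scope ring_scope.

(* Euclidean balls: the norm MathComp-Analysis puts on row vectors is the sup
   norm. For n = 0 both balls are the whole (one-point) space. *)
Definition closed_unit_ball (R : realType) (n : nat) : set 'rV[R]_n :=
  [set x | \sum_i x 0 i ^+ 2 <= 1].

Definition open_unit_ball (R : realType) (n : nat) : set 'rV[R]_n :=
  [set x | \sum_i x 0 i ^+ 2 < 1].

Definition homeomorphism_between (X Y : topologicalType)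
    (A : set X) (B : set Y) (f : X -> Y) : Prop :=
  [/\ f @` A = B,
      {within A, continuous f} &
      exists2 g : Y -> X,
        {within B, continuous g} & forall x, A x -> g (f x) = x].

(* A finite regular CW complex filling the whole space X. No further condition
   on the topology is needed since there are finitely many cells. *)
Record regular_cw (R : realType) (X : topologicalType) := RegularCW {
  label :> finType;
  cell_dim : label -> nat;
  cell : label -> set X;
  char_map : forall v : label, 'rV[R]_(cell_dim v) -> X;
  cw_hausdorff : hausdorff_space X;
  cw_cover : \bigcup_v cell v = setT;
  cw_disjoint : forall u v, u != v -> cell u `&` cell v = set0;
  cw_char_map : forall v,
    homeomorphism_between (@closed_unit_ball R (cell_dim v)) (closure (cell v))
                          (@char_map v);
  cw_char_map_open : forall v,
    @char_map v @` @open_unit_ball R (cell_dim v) = cell v;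
  cw_boundary : forall v, exists2 A : set label,
    closure (cell v) `\` cell v = \bigcup_(u in A) cell u &
    forall u, A u ->
      (cell_dim u < cell_dim v)%N /\ closure (cell u) `<=` \bigcup_(w in A) cell w
}.

Section Complexes.
Variables (R : realType) (X : topologicalType) (C : regular_cw R X).

Definition boundary (v : C) : set X := closure (cell v) `\` cell v.

Definition in_closure (u v : C) : Prop := cell u `<=` closure (cell v).

(* Values of etail and ehead on cells that are not edges are irrelevant. *)
Record orientation := Orientation {
  etail : C -> C;
  ehead : C -> C;
  orientation_ends : forall e, cell_dim e = 1%N ->
    etail e != ehead e /\ boundary e = cell (etail e) `|` cell (ehead e)
}.

Section Oriented.
Variable o : orientation.

(* p lists the successive edges of a directed path from x to y *)
Fixpoint dpath (x : C) (p : seq C) (y : C) : bool :=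
  if p is e :: p' then [&& cell_dim e == 1%N, etail o e == x & dpath (ehead o e) p' y]
  else x == y.

Definition acyclic : Prop := forall x p, dpath x p x -> p = [::].

Definition is_source (v : C) : Prop :=
  cell_dim v = 0%N /\ forall e, cell_dim e = 1%N -> ehead o e != v.

Definition is_sink (v : C) : Prop :=
  cell_dim v = 0%N /\ forall e, cell_dim e = 1%N -> etail o e != v.

Definition bipolar (N S : C) : Prop :=
  [/\ acyclic,
      forall v, is_source v <-> v = N &
      forall v, is_sink v <-> v = S].

End Oriented.

Definition path_set (p : seq C) : set X :=
  \bigcup_(e in [set` p]) closure (cell e).

Definition first_edge (p : seq C) (e : C) : Prop := exists p', p = e :: p'.

Definition last_edge (p : seq C) (e : C) : Prop := exists p', p = rcons p' e.

Definition is_component (D H : set X) : Prop :=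
  exists2 x, D x & H = connected_component D x.

(* f is a face in H with the edge e in its boundary *)
Definition face_at (H : set X) (e f : C) : Prop :=
  [/\ cell_dim f = 2%N, cell f `<=` H & in_closure e f].

Definition share_edge_of (p : seq C) (f g : C) : Prop :=
  exists e, [/\ e \in p, in_closure e f & in_closure e g].

Definition faces_in (H : set X) : {set C} :=
  [set f : C | (cell_dim f == 2%N) && `[< cell f `<=` H >]]%SET.

Definition edge_ends (e u v : C) : Prop :=
  cell_dim e = 1%N /\ boundary e = cell u `|` cell v.

Definition edge_neighbors (u v : C) : Prop :=
  u != v /\ exists e, edge_ends e u v.

Record template := Template {
  tcenter : C;
  torient : orientation;
  tN : C;
  tS : C;
  tWE : seq C;
  tEW : seq C;
  tW : set X;
  tE : set X;
  tNE : C;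
  tSW : C;
  tNW : C;
  tSE : C;
  tcenter_dim : cell_dim tcenter = 3%N;
  tcenter_closure : closure (cell tcenter) = setT;
  tbipolar : bipolar torient tN tS;
  tWE_path : dpath torient tN tWE tS;
  tEW_path : dpath torient tN tEW tS;
  tmeridians_disjoint :
    path_set tWE `&` path_set tEW = cell tN `|` cell tS;
  themispheres :
    let D := boundary tcenter `\` (path_set tWE `|` path_set tEW) in
    [/\ is_component D tW, is_component D tE,
        tW `&` tE = set0 & tW `|` tE = D];
  tW_edges : forall e v, cell_dim e = 1%N -> cell e `<=` tW ->
    v = etail torient e \/ v = ehead torient e ->
    cell v `<=` path_set tWE `|` path_set tEW -> v != tN -> v != tS ->
    v = ehead torient e;
  tE_edges : forall e v, cell_dim e = 1%N -> cell e `<=` tE ->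
    v = etail torient e \/ v = ehead torient e ->
    cell v `<=` path_set tWE `|` path_set tEW -> v != tN -> v != tS ->
    v = etail torient e;
  tNE_unique : exists2 e, first_edge tWE e & unique (face_at tW e) tNE;
  tSW_unique : exists2 e, last_edge tWE e & unique (face_at tE e) tSW;
  tNE_SW : share_edge_of tWE tNE tSW;
  tNW_unique : exists2 e, first_edge tEW e & unique (face_at tW e) tNW;
  tSE_unique : exists2 e, last_edge tEW e & unique (face_at tE e) tSE;
  tNW_SE : share_edge_of tEW tNW tSE
}.

Definition face_count_eta (T : template) : nat :=
  minn #|faces_in (tW T)| #|faces_in (tE T)|.

Definition shared_nonmeridian_edge (T : template) (f g e : C) : Prop :=
  [/\ cell_dim e = 1%N, in_closure e f, in_closure e g,
      e \notin tWE T & e \notin tEW T].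

End Complexes.

(* The regular icosahedron as the convex hull of the twelve cyclic permutations
   of (0, +-1, +-phi), phi the golden ratio; index arithmetic is modulo 3. *)
Definition ico_vertex : finType := ('I_3 * bool * bool)%type.

Definition golden (R : realType) : R := (1 + Num.sqrt 5) / 2.

Definition ico_pos (R : realType) (v : ico_vertex) : 'rV[R]_3 :=
  let: (k, s, t) := v in
  \row_(i < 3) (if i == k then 0
                else if i == k + 1 then (-1) ^+ s
                else (-1) ^+ t * golden R).

Definition dotv (R : realType) (n : nat) (x y : 'rV[R]_n) : R :=
  \sum_i x 0 i * y 0 i.

(* S is the vertex set of a nonempty face of the solid icosahedron, i.e. of the
   set where some linear functional is maximal on it. The functional 0 gives
   the whole solid. *)
Definition ico_face (R : realType) (S : {set ico_vertex}) : Prop :=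
  exists w : 'rV[R]_3, forall v,
    v \in S <-> forall u, dotv w (ico_pos R u) <= dotv w (ico_pos R v).

(* C and the solid icosahedron are isomorphic cell complexes: a regular complex
   is determined, up to cellular homeomorphism, by the inclusions between its
   closed cells. *)
Definition solid_icosahedron (R : realType) (X : topologicalType)
    (C : regular_cw R X) : Prop :=
  exists phi : C -> {set ico_vertex},
    [/\ injective phi,
        forall S, ico_face R S <-> exists v, phi v = S &
        forall u v, in_closure u v <-> phi u \subset phi v].

(* Main.v *)
Require Import Defs.
From HB Require Import structures.
From mathcomp Require Import all_boot all_order all_algebra.
From mathcomp Require Import all_classical all_reals all_analysis.
From mathcomp Require Import zify ring lra.

(** Every closed cell of the icosahedron other than the whole solid is a clique
    of its edge graph.  The two triangles in condition (iv) contain the first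
    and the last edge of a meridian and share an edge of it, so each meridian
    has at most three edges.  On a meridian with three edges both inner vertices
    are adjacent to both poles; a second meridian of length at most 2 (which
    makes the poles adjacent) then gives a complete graph on four vertices, and
    one of length 3 gives four common neighbors of the poles, neither of which
    exists in the icosahedron.  Hence the poles [n], [s] are adjacent and the
    meridian vertices are [n], [s] and one or two common neighbors [a], [c] of
    the poles.  The remaining vertices are connected by edges through the ring
    of neighbors of the antipode of [n], so they lie in one hemisphere; the
    faces of the other hemisphere are among the triangles [nsa] and [nsc]. *)

Set Implicit Arguments.
Unset Strict Implicit.
Unset Printing Implicit Defensive.

Import Order.TTheory GRing.Theory Num.Theory.
Import numFieldNormedType.Exports.

Local Open Scope ring_scope.

(** * The edge graph of the icosahedron *)

(** A combinatorial form of [dotv (ico_pos u) (ico_pos v) = golden], that is, of distance 2, the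
    edge length; see [dotv_pos]. It lets finite statements be decided by computation. *)
Definition adj (u v : ico_vertex) : bool :=
  let: (k, s, t) := u in let: (k', s', t') := v in
  if k == k' then (s != s') && (t == t')
  else if k' == k + 1 then t == s' else t' == s.

Definition antipode (u : ico_vertex) : ico_vertex :=
  let: (k, s, t) := u in (k, ~~ s, ~~ t).

(** An explicit list, so that quantifiers over vertices become closed boolean terms for
    [vm_compute]. *)
Definition ico_vertices : seq ico_vertex :=
  let signs := [:: (true, true); (true, false); (false, true); (false, false)] in
  [seq (k, st.1, st.2) | k <- [:: 0; 1; 1 + 1], st <- signs].

Lemma mem_ico_vertices u : u \in ico_vertices.
Proof.
case: u => [[[[|[|[|m]]] lt_k3] s] t] //; rewrite (bool_irrelevance lt_k3 isT);
  by case: s; case: t.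
Qed.

Lemma ico_forall (P : pred ico_vertex) : all P ico_vertices -> forall u, P u.
Proof. by move=> /allP Pall u; apply: Pall; apply: mem_ico_vertices. Qed.

Lemma ico_exists (P : pred ico_vertex) : has P ico_vertices -> exists u, P u.
Proof. by case/hasP=> u _ Pu; exists u. Qed.

Lemma adj_irr u : adj u u = false.
Proof. by case: u => -[k s] t; rewrite /adj !eqxx. Qed.

Lemma adj_sym u v : adj u v = adj v u.
Proof.
apply/eqP; move: v; apply: ico_forall; move: u; apply: ico_forall.
by vm_compute.
Qed.

(** Seen from [u], the twelve vertices form layers of sizes 1, 5, 5, 1; the last two are the
    antipode and its ring of neighbors. *)
Lemma antipode_dichotomy u v :
  [|| v == u, adj u v, v == antipode u | adj (antipode u) v].
Proof.
by move: v; apply: ico_forall; move: u; apply: ico_forall; vm_compute.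
Qed.

Lemma adj_antipode u v : adj (antipode u) v -> (v != u) && ~~ adj u v.
Proof.
by apply/implyP; move: v; apply: ico_forall; move: u; apply: ico_forall; vm_compute.
Qed.

Lemma antipode_far u : (antipode u != u) && ~~ adj u (antipode u).
Proof. by move: u; apply: ico_forall; vm_compute. Qed.

Definition neighbors u := [seq v <- ico_vertices | adj u v].

Lemma mem_neighbors u v : (v \in neighbors u) = adj u v.
Proof. by rewrite mem_filter mem_ico_vertices andbT. Qed.

Lemma neighbors_forall (P : pred ico_vertex) u :
  all P (neighbors u) -> forall v, adj u v -> P v.
Proof. by move=> /allP Pall v uv; apply: Pall; rewrite mem_neighbors. Qed.

Lemma neighbors_exists (P : pred ico_vertex) u :
  has P (neighbors u) -> exists2 v, adj u v & P v.
Proof. by case/hasP=> v; rewrite mem_neighbors; exists v. Qed.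

(** Used to walk in one step from the ring around [u] to the ring around its antipode. *)
Lemma adj_to_antipode_link u v : adj u v -> exists2 w, adj v w & adj (antipode u) w.
Proof.
move=> uv; apply: neighbors_exists; move: v uv; apply: neighbors_forall.
by move: u; apply: ico_forall; vm_compute.
Qed.

Lemma adj_extend u v : adj u v -> exists2 w, adj u w & adj v w.
Proof.
move=> uv; apply: neighbors_exists; move: v uv; apply: neighbors_forall.
by move: u; apply: ico_forall; vm_compute.
Qed.

Lemma adj_exists u : exists v, adj u v.
Proof. by apply: ico_exists; move: u; apply: ico_forall; vm_compute. Qed.

(** Distinct vertices have exactly two common neighbors, or none if they are antipodal. *)
Lemma three_common_neighbors u v a b c : u != v -> uniq [:: a; b; c] ->
  all (fun w => adj u w && adj v w) [:: a; b; c] -> False.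
Proof.
have le2 : (u != v) ==> (size [seq w <- neighbors u | adj v w] <= 2)%N.
  by move: v; apply: ico_forall; move: u; apply: ico_forall; vm_compute.
move=> /(implyP le2) {}le2 uniq_s /allP adj_s.
have : (3 <= 2)%N; last by [].
apply: leq_trans le2; apply: (uniq_leq_size (s1 := [:: a; b; c])) => // w /adj_s.
by rewrite mem_filter mem_neighbors andbC.
Qed.

(** The neighbors of [a] form a 5-cycle, which contains no triangle. *)
Lemma no_K4 a b c d : adj a b -> adj a c -> adj a d -> adj b c -> adj b d ->
  ~~ adj c d.
Proof.
move=> ab ac ad bc bd; apply/negP => cd.
have : adj b c ==> ~~ (adj b d && adj c d); last by rewrite bc bd cd.
move: d ad {bd cd}; apply: neighbors_forall.
move: c ac {bc}; apply: neighbors_forall; move: b ab; apply: neighbors_forall.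
by move: a; apply: ico_forall; vm_compute.
Qed.

(** Four consecutive vertices of the pentagon around [u] span three triangles with [u]. *)
Lemma adj_fan u : exists a b c d,
  [/\ uniq [:: a; b; c; d], all (adj u) [:: a; b; c; d], adj a b, adj b c & adj c d].
Proof.
have : has (fun a => has (fun b => has (fun c => has (fun d =>
  [&& uniq [:: a; b; c; d], adj a b, adj b c & adj c d])
  (neighbors u)) (neighbors u)) (neighbors u)) (neighbors u).
  by move: u; apply: ico_forall; vm_compute.
case/neighbors_exists=> a ua /neighbors_exists[b ub] /neighbors_exists[c uc].
case/neighbors_exists=> d ud /and4P[? ? ? ?].
by exists a, b, c, d; split=> //; rewrite /= ua ub uc ud.
Qed.

Definition clique (S : {set ico_vertex}) : Prop :=
  (exists u, u \in S) /\ {in S &, forall u v, u != v -> adj u v}.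

(** * Faces of the convex icosahedron *)

Section Faces.
Variable R : realType.
Implicit Types w : 'rV[R]_3.
Local Notation phi := (golden R).
Local Notation pos := (ico_pos R).

Lemma golden_gt1 : 1 < phi.
Proof.
have : 1 < Num.sqrt (5 : R) by rewrite -[X in X < _]sqrtr1 ltr_sqrt ?ltr1n.
rewrite /golden; lra.
Qed.

Lemma golden_sqr : phi ^+ 2 = phi + 1.
Proof.
have : Num.sqrt (5 : R) ^+ 2 = 5 by rewrite sqr_sqrtr.
by rewrite /golden => h; field: h.
Qed.

Lemma dotvC (x y : 'rV[R]_3) : dotv x y = dotv y x.
Proof. by apply: eq_bigr => i _; rewrite mulrC. Qed.

Lemma dotvDl (x y z : 'rV[R]_3) : dotv (x + y) z = dotv x z + dotv y z.
Proof. by rewrite -big_split; apply: eq_bigr => i _; rewrite mxE mulrDl. Qed.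

Lemma dotv_suml (S : {set ico_vertex}) (f : ico_vertex -> 'rV[R]_3) z :
  dotv (\sum_(u in S) f u) z = \sum_(u in S) dotv (f u) z.
Proof.
rewrite /dotv exchange_big /=; apply: eq_bigr => i _.
by rewrite summxE mulr_suml.
Qed.

Lemma dotv_antipode w u : dotv w (pos (antipode u)) = - dotv w (pos u).
Proof.
rewrite /dotv -sumrN; apply: eq_bigr => i _; rewrite -mulrN; congr (_ * _).
case: u => -[k s] t; rewrite !mxE.
do 2?case: ifP => _; rewrite ?oppr0 //.
  by case: s; rewrite ?expr0 ?expr1 ?opprK.
by case: t; rewrite ?expr0 ?expr1 ?mulN1r ?mul1r ?opprK.
Qed.


Lemma dotv3 (x y : 'rV[R]_3) :
  dotv x y = x 0 0 * y 0 0 + x 0 1 * y 0 1 + x 0 (1 + 1) * y 0 (1 + 1).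
Proof.
rewrite /dotv !big_ord_recl big_ord0 addr0 addrA.
by congr (_ * _ + _ * _ + _ * _); congr (_ _ _); apply: val_inj.
Qed.

Lemma dotv_pos u v : dotv (pos u) (pos v) =
  if u == v then phi + 2 else if adj u v then phi
  else if v == antipode u then - (phi + 2) else - phi.
Proof.
have g2 := golden_sqr.
case: u => [[[[|[|[|m]]] h] s] t] //; case: v => [[[[|[|[|m']]] h'] s'] t'] //;
  rewrite (bool_irrelevance h isT) (bool_irrelevance h' isT).
all: rewrite dotv3 !mxE; case: s; case: t; case: s'; case: t' => /=.
all: by rewrite ?expr0 ?expr1; ring: g2.
Qed.

(* Two vertices at distance two are opposite corners of the union of two
   triangles; the midpoints of that diagonal and of the common edge of the
   triangles lie on one ray from the center, in golden ratio. *)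
Definition short_diagonal (u v : ico_vertex) : ico_vertex * ico_vertex :=
  let: (k, s, t) := u in let: (k', s', t') := v in
  if k == k' then ((k + 2, false, s), (k + 2, true, s))
  else if k' == k + 1 then ((k', t, t'), (k' + 1, t', s))
  else ((k, t', t), (k + 1, t, s')).

Lemma golden_rhombus u v : u != v -> ~~ adj u v -> v != antipode u ->
  phi *: (pos u + pos v) = pos (short_diagonal u v).1 + pos (short_diagonal u v).2.
Proof.
have g2 := golden_sqr.
case: u => [[[[|[|[|m]]] h] s] t] //; case: v => [[[[|[|[|m']]] h'] s'] t'] //;
  rewrite (bool_irrelevance h isT) (bool_irrelevance h' isT).
all: case: s; case: t; case: s'; case: t' => //= _ _ _; apply/rowP=> -[[|[|[|i]]] hi] //.
all: rewrite !mxE /= ?expr0 ?expr1; ring: g2.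
Qed.

(** A clique is exposed by the sum of its vertices, whose inner product is [phi *+ #|S| + 2] with
    members and at most [phi *+ #|S|] with other vertices. Conversely, two nonadjacent maximizers
    are excluded by central symmetry or by [golden_rhombus]. *)
Lemma ico_faceP (S : {set ico_vertex}) :
  ico_face R S <-> clique S \/ S = [set: ico_vertex]%SET.
Proof.
have phi1 := golden_gt1.
split=> [[w w_max]|[[[u0 Su0] Sadj]|->]]; last first.
- exists 0 => v; rewrite inE; split=> // _ u.
  by rewrite !dotv3 !mxE !mul0r.
- exists (\sum_(v in S) pos v) => v.
  have inS x : x \in S ->
      dotv (\sum_(v in S) pos v) (pos x) = phi *+ #|S| + 2.
    move=> Sx; rewrite dotv_suml (bigD1 x) //= dotv_pos eqxx.
    rewrite (eq_bigr (fun=> phi)) => [|y /andP[Sy yx]]; last first.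
      by rewrite dotv_pos (negbTE yx) Sadj.
    rewrite sumr_const (cardD1 x S) Sx add1n (mulrS phi) addrAC; congr (_ + _ + _).
    by congr (_ *+ _); apply: eq_card => y; rewrite !inE andbC.
  have outS x : x \notin S -> dotv (\sum_(v in S) pos v) (pos x) <= phi *+ #|S|.
    move=> Sx; rewrite dotv_suml -sumr_const; apply: ler_sum => y Sy.
    rewrite dotv_pos; case: eqP Sy Sx => [-> ->//|_ _ _].
    by do 2?case: ifP => _; lra.
  split=> [Sv u|v_max].
    rewrite (inS v) //; have [Su|Su] := boolP (u \in S); first by rewrite inS.
    by have := outS u Su; lra.
  apply: contraT => /outS; have := v_max u0; rewrite (inS u0) //; lra.
have [S_T|SnT] := eqVneq S [set: ico_vertex]%SET; [by right|left].
have [u0 Su0] : exists u, u \in S.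
  exists [arg max_(v > (0, true, true) : ico_vertex) dotv w (pos v)]%O.
  by apply/w_max => u; case: arg_maxP => // v _; apply.
(* If the maximum were at most 0, then by central symmetry [w] would vanish on every vertex and [S]
   would be everything. *)
have posM u : u \in S -> 0 < dotv w (pos u).
  move=> /w_max u_max; rewrite ltNge; apply: contra SnT => u_le0.
  have zero v : dotv w (pos v) = 0.
    have := u_max v; have := u_max (antipode v); rewrite dotv_antipode; lra.
  by apply/eqP/setP => v; rewrite inE; apply/w_max => x; rewrite !zero.
split=> [|u v Su Sv uv]; first by exists u0.
apply: contraT => uNv; have M_gt0 := posM _ Su.
have eqM : dotv w (pos u) = dotv w (pos v).
  by apply/le_anti; rewrite (w_max _).1 // (w_max _).1.
have [v_opp|v_nopp] := eqVneq v (antipode u).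
  by move: eqM; rewrite v_opp dotv_antipode; lra.
(* With [M > 0] the common value at [u] and [v], the values at the two vertices of [ab] add up to
   [2 * phi * M > 2 * M], so one of them exceeds the maximum. *)
have := congr1 (dotv w) (golden_rhombus uv uNv v_nopp).
set ab := short_diagonal u v.
have := (w_max u).1 Su ab.1; have := (w_max u).1 Su ab.2.
have dotDr (x y z : 'rV[R]_3) : dotv x (y + z) = dotv x y + dotv x z.
  by rewrite dotvC dotvDl !(dotvC x).
have dotZr c (x y : 'rV[R]_3) : dotv x (c *: y) = c * dotv x y.
  by rewrite !dotv3 !mxE; ring.
rewrite dotZr !dotDr -eqM; nra.
Qed.
End Faces.

(** * Regular CW complexes *)

Local Open Scope classical_set_scope.
Local Open Scope ring_scope.

Lemma open_unit_ball0 (R : realType) n : @open_unit_ball R n 0.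
Proof. by rewrite /open_unit_ball /= big1 ?ltr01 // => i _; rewrite mxE expr0n. Qed.

(** Such a [B] is star-shaped about 0: a segment from 0 to a point of [B] lies in the open ball,
    except possibly for that end point. [B] may contain any part of the bounding sphere. *)
Lemma unit_ball_connected (R : realType) n (B : set 'rV[R]_n) :
  @open_unit_ball R n `<=` B -> B `<=` @closed_unit_ball R n -> connected B.
Proof.
move=> openB Bclosed.
pose ray (x : 'rV[R]_n) := (fun t : R => t *: x) @` `[0, 1].
have -> : B = \bigcup_(x in B) ray x.
  apply/seteqP; split=> x.
    move=> Bx; exists x => //; exists 1; last by rewrite scale1r.
    by rewrite /= in_itv /= ler01 lexx.
  move=> [y By] [t]; rewrite /= in_itv /= => /andP[t0 t1] <-.
  have [->|t_neq1] := eqVneq t 1; first by rewrite scale1r.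
  apply: openB; rewrite /open_unit_ball /=.
  rewrite (eq_bigr (fun i => t ^+ 2 * y 0 i ^+ 2)); last first.
    by move=> i _; rewrite mxE exprMn.
  rewrite -mulr_sumr.
  have : \sum_i y 0 i ^+ 2 <= 1 := Bclosed _ By.
  have : t ^+ 2 < 1 by rewrite expr_lt1 // lt_neqAle t_neq1.
  have : 0 <= \sum_i y 0 i ^+ 2 by apply: sumr_ge0 => i _; apply: sqr_ge0.
  have : 0 <= t ^+ 2 by apply: sqr_ge0.
  nra.
apply: bigcup_connected.
  exists 0 => x _; exists 0; last by rewrite scale0r.
  by rewrite /= in_itv /= ler01 lexx.
move=> x _; apply: connected_continuous_connected; first exact: segment_connected.
apply: continuous_subspaceT => t; exact: scalel_continuous.
Qed.

Section RegularCW.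
Variables (R : realType) (X : topologicalType) (C : regular_cw R X).
Implicit Types u v w : C.

Lemma cell_nonempty v : cell v !=set0.
Proof.
exists (@char_map _ _ C v 0); rewrite -cw_char_map_open.
by exists 0 => //; apply: open_unit_ball0.
Qed.

Lemma cell_inj u v x : cell u x -> cell v x -> u = v.
Proof.
move=> ux vx; apply: contrapT => /eqP/cw_disjoint uv0.
by have : (cell u `&` cell v) x by []; rewrite uv0.
Qed.

Lemma in_closure_refl v : in_closure v v.
Proof. exact: subset_closure. Qed.

(** The boundary of [v] is a union of cells, and cells are disjoint, so one common point forces the
    whole cell [u] into the closure. *)
Lemma cell_meets_closure u v x : cell u x -> closure (cell v) x -> in_closure u v.
Proof.
move=> ux vx; have [vx'|vNx] := pselect (cell v x).
  by rewrite (cell_inj ux vx'); apply: in_closure_refl.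
have [A bdA _] := cw_boundary v.
have : (closure (cell v) `\` cell v) x by [].
rewrite bdA => -[w Aw /(cell_inj ux) uw]; rewrite -{}uw in Aw.
move=> y uy; suff: (closure (cell v) `\` cell v) y by case.
by rewrite bdA; exists u.
Qed.

Lemma in_closure_dim u v : in_closure u v -> u != v -> (cell_dim u < cell_dim v)%N.
Proof.
move=> uv neq_uv; have [x ux] := cell_nonempty u.
have [A bdA dimA] := cw_boundary v.
have : (closure (cell v) `\` cell v) x.
  by split; [apply: uv|move=> /(cell_inj ux) /eqP; rewrite (negbTE neq_uv)].
by rewrite bdA => -[w /dimA [ltw _] /(cell_inj ux) ->].
Qed.

Lemma boundary_in_closure u v x : cell u x -> boundary v x ->
  in_closure u v /\ u != v.
Proof.
move=> ux [cvx vNx]; split; first exact: cell_meets_closure ux cvx.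
by apply/eqP => uv; apply: vNx; rewrite -uv.
Qed.

(** The union is the image, under the characteristic map of [v], of a set between the open and the
    closed ball. *)
Lemma cell_setU_connected u v : in_closure u v -> connected (cell u `|` cell v).
Proof.
move=> uv; have [im_char cont_char _] := cw_char_map v.
pose B := @closed_unit_ball R (cell_dim v) `&`
          @char_map _ _ C v @^-1` (cell u `|` cell v).
have -> : cell u `|` cell v = @char_map _ _ C v @` B.
  apply/seteqP; split=> [y uvy|y [x [_ uvx] <-] //].
  have : closure (cell v) y.
    by case: uvy => [/uv//|]; apply: subset_closure.
  by rewrite -im_char => -[x Bx xy]; exists x => //; split=> //; rewrite /preimage /= xy.
apply: connected_continuous_connected.
  apply: unit_ball_connected => [x Bx|x []//].
  split; first exact: ltW Bx.
  by right; rewrite -cw_char_map_open; exists x.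
by apply: continuous_subspaceW cont_char => x [].
Qed.

Lemma path_set_cell (p : seq C) u x : cell u x -> path_set p x ->
  exists2 e, e \in p & in_closure u e.
Proof. by move=> ux [e pe ex]; exists e => //; apply: cell_meets_closure ux ex. Qed.
End RegularCW.

Section Components.
Variables (X : topologicalType) (D : set X).

Lemma component_absorbs (H Y : set X) y : is_component D H -> connected Y ->
  Y `<=` D -> Y y -> H y -> Y `<=` H.
Proof.
move=> [x Dx ->] cY YD Yy xy.
rewrite (same_connected_component xy); exact: connected_component_max.
Qed.
End Components.

(** * Cells of the solid icosahedron as cliques *)

Local Close Scope ring_scope.

Lemma clique1 u : clique [set u]%SET.
Proof.
split; first by exists u; rewrite inE.
by move=> x y; rewrite !inE => /eqP-> /eqP->; rewrite eqxx.
Qed.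

Lemma cliqueU1 u S : clique S -> {in S, forall v, adj u v} -> clique (u |: S)%SET.
Proof.
move=> [_ Sadj] uS; split; first by exists u; rewrite setU11.
move=> x y; rewrite !inE => /predU1P[->|Sx] /predU1P[->|Sy].
- by rewrite eqxx.
- by move=> _; apply: uS.
- by move=> _; rewrite adj_sym; apply: uS.
- exact: Sadj.
Qed.

Lemma clique2 u v : adj u v -> clique [set u; v]%SET.
Proof. by move=> uv; apply: cliqueU1 (clique1 v) _ => x; rewrite inE => /eqP->. Qed.

Lemma clique3 u v w : adj u v -> adj u w -> adj v w -> clique [set u; v; w]%SET.
Proof.
move=> uv uw vw; rewrite -finset.setUA; apply: cliqueU1 (clique2 vw) _ => x.
by rewrite !inE => /orP[]/eqP->.
Qed.

Lemma cliqueD1 S u v : clique S -> v \in S -> v != u -> clique (S :\ u)%SET.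
Proof.
move=> [_ Sadj] Sv vu; split; first by exists v; rewrite !inE vu.
by move=> x y; rewrite !inE => /andP[_ Sx] /andP[_ Sy]; apply: Sadj.
Qed.

Lemma clique_no4 S a b c d : clique S -> uniq [:: a; b; c; d] ->
  a \in S -> b \in S -> c \in S -> d \in S -> False.
Proof.
move=> [_ Sadj]; rewrite /= !inE !negb_or.
move=> /and4P[/and3P[ab ac ad] /andP[bc bd] cd _] Sa Sb Sc Sd.
have := @no_K4 a b c d; rewrite !Sadj // => /(_ isT isT isT isT isT); exact: negP.
Qed.

Lemma clique_card S : clique S -> 0 < #|S| <= 3.
Proof.
move=> cS; apply/andP; split; first by have [[u Su] _] := cS; apply/card_gt0P; exists u.
have memS x : (x \in enum S) = (x \in S) by rewrite mem_enum.
have := enum_uniq S; rewrite cardE.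
case: (enum S) memS => [|a [|b [|c [|d s]]]] // memS uniqS; exfalso.
apply: (@clique_no4 S a b c d); rewrite -?memS ?inE ?eqxx ?orbT //.
move: uniqS; rewrite /= !inE !negb_or.
by move=> /and5P[/and4P[-> -> -> _] /and3P[-> -> _] /andP[-> _]].
Qed.

(** Every vertex lies on an edge and every edge on a triangle; this bounds dimensions from above in
    [dim_le]. *)
Lemma clique_extend S : clique S -> #|S| < 3 ->
  exists2 x, x \notin S & clique (x |: S)%SET.
Proof.
move=> cS; have /andP[] := clique_card cS; have Sadj := cS.2.
case cardS: #|S| => [|[|[|//]]] // _ _.
  have /eqP/cards1P[u Su] := cardS; have [v uv] := adj_exists u.
  exists v; first by rewrite Su inE; apply: contraL uv => /eqP->; rewrite adj_irr.
  by rewrite Su; apply: clique2; rewrite adj_sym.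
have /eqP/cards2P[u [v [uv Su]]] := cardS.
have /adj_extend[w uw vw] : adj u v by rewrite Sadj // Su !inE eqxx ?orbT.
exists w.
  rewrite Su !inE negb_or.
  by apply/andP; split; [apply: contraL uw|apply: contraL vw] => /eqP->; rewrite adj_irr.
by apply: cliqueU1 => // x; rewrite Su !inE adj_sym => /orP[]/eqP->.
Qed.

(** * Dimensions of the cells of the complex *)

Section IcosahedralComplex.
Variables (R : realType) (X : topologicalType) (C : regular_cw R X).
Variables (phi : C -> {set ico_vertex}) (center : C).
Hypothesis phi_inj : injective phi.
Hypothesis phi_face : forall S, ico_face R S <-> exists v, phi v = S.
Hypothesis phi_sub : forall u v : C, in_closure u v <-> phi u \subset phi v.
Hypothesis center_dim : cell_dim center = 3.
Hypothesis center_closure : closure (cell center) = setT.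
Implicit Types u v e f : C.

Lemma clique_cell S : clique S -> exists v, phi v = S.
Proof. by move=> cS; apply/phi_face/ico_faceP; left. Qed.

Definition pt x : C := sval (cid (clique_cell (clique1 x))).

Lemma phi_pt x : phi (pt x) = [set x]%SET.
Proof. exact: svalP (cid (clique_cell (clique1 x))). Qed.

Lemma pt_inj : injective pt.
Proof. by move=> x y /(congr1 phi); rewrite !phi_pt => /finset.set1_inj. Qed.

Lemma phi_center : phi center = [set: ico_vertex]%SET.
Proof.
apply/finset.setP => x; rewrite [RHS]inE -finset.sub1set -phi_pt.
by apply/phi_sub; rewrite /in_closure center_closure.
Qed.

Lemma noncenter_clique v : v != center -> clique (phi v).
Proof.
move=> vc; have /ico_faceP[//|vT] : ico_face R (phi v) by apply/phi_face; exists v.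
by case/eqP: vc; apply: phi_inj; rewrite phi_center.
Qed.

Lemma clique_noncenter v : clique (phi v) -> v != center.
Proof.
move=> /clique_card/andP[_]; apply: contraTneq => ->.
by rewrite phi_center cardsT !card_prod card_ord card_bool.
Qed.

Lemma dim_lt u v : phi u \proper phi v -> cell_dim u < cell_dim v.
Proof.
move=> uv; apply: in_closure_dim; first by apply/phi_sub/proper_sub.
by apply: contraTneq uv => ->; rewrite fintype.properxx.
Qed.

(** Only inclusions are transported by [phi], so dimensions are recovered from strict monotonicity:
    deleting vertices one by one gives a descending chain of cells. *)
Lemma dim_ge v : clique (phi v) -> #|phi v| <= (cell_dim v).+1.
Proof.
move: {2}#|phi v| (leqnn #|phi v|) => n; elim: n v => [|n IHn] v len cv.
  by rewrite (leq_trans len).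
have [x vx] := cv.1; have [le1|gt1] := leqP #|phi v| 1; first exact: leq_trans le1 _.
have [y yx vy] : exists2 y, y != x & y \in phi v.
  move: gt1; rewrite (cardsD1 x) vx ltnS => /card_gt0P[y].
  by rewrite !inE => /andP[]; exists y.
have [u uE] := clique_cell (cliqueD1 cv vy yx).
have vuE : #|phi v| = #|phi u|.+1 by rewrite uE (cardsD1 x) vx.
rewrite vuE ltnS; apply: leq_trans (_ : (cell_dim u).+1 <= _).
  apply: IHn; first by rewrite -ltnS -vuE.
  by rewrite uE; apply: cliqueD1 cv vy yx.
by apply: dim_lt; rewrite uE properD1.
Qed.

(** Adding vertices gives an ascending chain up to a triangle, which is properly contained in the
    center of dimension 3. *)
Lemma dim_le v : clique (phi v) -> cell_dim v < #|phi v|.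
Proof.
move: {2}(3 - #|phi v|) (leqnn (3 - #|phi v|)) => n; elim: n v => [|n IHn] v len cv;
  have /andP[_ le3] := clique_card cv.
  have -> : #|phi v| = cell_dim center.
    by apply/eqP; rewrite center_dim eqn_leq le3 -subn_eq0 -leqn0.
  apply: dim_lt; rewrite phi_center finset.properT.
  by apply: contraNneq (clique_noncenter cv) => vT; apply/eqP/phi_inj; rewrite phi_center.
have [ge3|lt3] := leqP 3 #|phi v|.
  (* [3 <= k] unfolds to [3 - k == 0], so the induction hypothesis applies to [v] itself. *)
  by apply: IHn cv; move/eqP: ge3 => ->.
have [x vNx cx] := clique_extend cv lt3; have [u uE] := clique_cell cx.
have uvE : #|phi u| = #|phi v|.+1 by rewrite uE cardsU1 vNx.
rewrite -ltnS -uvE; apply: leq_ltn_trans (IHn u _ _); last 2 first.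
- by rewrite uvE; move: len lt3; lia.
- by rewrite uE.
by apply: dim_lt; rewrite uE properUr // finset.sub1set.
Qed.

Lemma card_phi v : v != center -> #|phi v| = (cell_dim v).+1.
Proof.
move=> /noncenter_clique cv; apply/eqP.
by rewrite eqn_leq dim_ge //= dim_le.
Qed.

Lemma dim_noncenter v : cell_dim v < 3 -> v != center.
Proof. by apply: contraTneq => ->; rewrite center_dim. Qed.

Lemma dim0_pt v : cell_dim v = 0 -> exists x, v = pt x.
Proof.
move=> v0; have := card_phi (@dim_noncenter v _); rewrite v0.
move=> /(_ isT)/eqP/cards1P[x vx].
by exists x; apply: phi_inj; rewrite phi_pt.
Qed.

Lemma pt_in_closure x v : in_closure (pt x) v <-> x \in phi v.
Proof. by rewrite phi_sub phi_pt finset.sub1set. Qed.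

Lemma face_clique f : cell_dim f = 2 -> clique (phi f).
Proof. by move=> f2; apply/noncenter_clique/dim_noncenter; rewrite f2. Qed.

Lemma boundary_edge_pt e v : cell_dim e = 1 -> cell v `<=` boundary e ->
  exists2 x, v = pt x & x \in phi e.
Proof.
move=> e1 ve; have [y vy] := cell_nonempty v.
have [cve neq_ve] := boundary_in_closure vy (ve _ vy).
have [x vx] : exists x, v = pt x.
  by apply: dim0_pt; have := in_closure_dim cve neq_ve; rewrite e1; case: cell_dim.
by exists x => //; apply/pt_in_closure; rewrite -vx.
Qed.

(** * Directed paths and the shape of a meridian *)

Section Oriented.
Variable o : orientation C.

Lemma oriented_edge e : cell_dim e = 1 ->
  exists x y, [/\ etail o e = pt x, ehead o e = pt y & phi e = [set x; y]%SET].
Proof.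
move=> e1; have [neq_th bde] := orientation_ends o e1.
have [x tx ex] : exists2 x, etail o e = pt x & x \in phi e.
  by apply: boundary_edge_pt => //; rewrite bde; apply: subsetUl.
have [y hy ey] : exists2 y, ehead o e = pt y & y \in phi e.
  by apply: boundary_edge_pt => //; rewrite bde; apply: subsetUr.
exists x, y; split=> //; apply/esym/eqP.
rewrite eqEcard finset.subUset !finset.sub1set ex ey /=.
rewrite card_phi ?dim_noncenter ?e1 // cards2.
by have [xy|//] := eqVneq x y; case/eqP: neq_th; rewrite tx hy xy.
Qed.

(** Here [xs] omits the starting vertex. The reachability clause is carried through the induction
    because it yields distinctness: a return to [x] would be a nonempty directed cycle. *)
Lemma dpath_vertices p x v : acyclic o -> dpath o (pt x) p v ->
  exists xs, [/\ size xs = size p, v = pt (last x xs), uniq (x :: xs),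
    forall z, z \in xs -> exists2 q, q <> [::] & dpath o (pt x) q (pt z) &
    forall i, i < size p ->
      phi (nth center p i) = [set nth x (x :: xs) i; nth x xs i]%SET].
Proof.
move=> acyc; elim: p x => [|e p IHp] x /=; first by move/eqP<-; exists [::].
case/and3P=> /eqP e1 /eqP tx; have [x' [y [tx' hy eE]]] := oriented_edge e1.
have xx' : x' = x by apply: pt_inj; rewrite -tx' -tx.
rewrite {x' tx'}xx' in eE *; rewrite hy => /IHp[ys [szys -> uniq_ys reach_ys edges_ys]].
have step q z : dpath o (pt y) q z -> dpath o (pt x) (e :: q) z.
  by rewrite /= e1 tx hy eqxx => ->; rewrite eqxx.
have reach z : z \in y :: ys -> exists2 q, q <> [::] & dpath o (pt x) q (pt z).
  rewrite inE => /predU1P[->|/reach_ys[q _ /step]]; last by exists (e :: q).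
  by exists [:: e] => //; apply: step; apply: eqxx.
exists (y :: ys); split=> //=; first by rewrite szys.
  by rewrite -cons_uniq; apply/andP; split=> //; apply/negP => /reach[q + /acyc].
case=> [_|i]; first by rewrite eE.
rewrite ltnS => ltip; rewrite [LHS]edges_ys //.
by congr [set _; _]%SET; apply: set_nth_default; rewrite /= szys // ltnW.
Qed.

(** The cases stand for one, two and three edges. In the third only the middle edge and the
    adjacencies are recorded, which suffices for a contradiction. *)
Inductive meridian_shape (p : seq C) (n s : ico_vertex) : Prop :=
| Meridian1 e of p = [:: e] & phi e = [set n; s]%SET & adj n s
| Meridian2 a e1 e2 of p = [:: e1; e2] & phi e1 = [set n; a]%SET &
    phi e2 = [set a; s]%SET & adj n s & adj n a & adj s a
| Meridian3 a b e of e \in p & phi e = [set a; b]%SET &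
    adj n a & adj n b & adj s a & adj s b & adj a b.

(* The three-element closures of [f] and [g] each contain two edges of the
   path, which forces the shared edge to be within one step of either end. *)
Lemma meridianP p n s e1 e2 f g : acyclic o -> dpath o (pt n) p (pt s) ->
  first_edge p e1 -> last_edge p e2 -> cell_dim f = 2 -> cell_dim g = 2 ->
  in_closure e1 f -> in_closure e2 g -> share_edge_of p f g ->
  meridian_shape p n s.
Proof.
move=> acyc np [p1 pe1] [p2 pe2] f2 g2 e1f e2g [e [pe ef eg]].
have [xs [szxs /pt_inj sE uniq_xs _ edges]] := dpath_vertices acyc np.
(* Edge [j] of the path joins [x j] to [x j.+1]; the shared edge has index [i] and the last edge
   index [l]. *)
pose x i := nth n (n :: xs) i; pose i := index e p; pose l := (size p).-1.
have lp : size p = l.+1 by rewrite /l pe1.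
have lt_i : i < size p by rewrite index_mem.
have edgeE j : j < size p -> phi (nth center p j) = [set x j; x j.+1]%SET.
  by move=> /edges ->.
have x_inj j k : j < size (n :: xs) -> k < size (n :: xs) -> (x j == x k) = (j == k).
  by move=> ltj ltk; rewrite nth_uniq.
rewrite /= szxs in x_inj.
have xl : x l.+1 = s by rewrite sE -lp -szxs /x nth_last.
have mem_edge j h : j < size p -> in_closure (nth center p j) h ->
    (x j \in phi h) && (x j.+1 \in phi h).
  by move=> ltj /phi_sub; rewrite edgeE // finset.subUset !finset.sub1set.
have e1E : e1 = nth center p 0 by rewrite pe1.
have e2E : e2 = nth center p l.
  by rewrite /l pe2 size_rcons nth_rcons ltnn eqxx.
have eE : e = nth center p i by rewrite nth_index.
have cf := face_clique f2; have cg := face_clique g2.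
have /andP[f0 f1] : (x 0 \in phi f) && (x 1 \in phi f).
  by apply: mem_edge; rewrite -?e1E ?lp.
have /andP[gl gl1] : (x l \in phi g) && (x l.+1 \in phi g).
  by apply: mem_edge; rewrite -?e2E ?lp.
have /andP[fi fi1] : (x i \in phi f) && (x i.+1 \in phi f).
  by apply: mem_edge; rewrite -?eE.
have /andP[gi gi1] : (x i \in phi g) && (x i.+1 \in phi g).
  by apply: mem_edge; rewrite -?eE.
(* Otherwise [f] would contain the four distinct vertices of the first and the shared edge; the next
   bound is the same argument for [g]. *)
have i_le1 : i <= 1.
  rewrite leqNgt; apply/negP => i_gt1.
  apply: (clique_no4 cf (a := x 0) (b := x 1) (c := x i) (d := x i.+1)) => //.
  rewrite /= !inE !x_inj; move: i_gt1 lt_i; rewrite ?lp;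
    by clear; move: i l => i l; lia.
have l_le : l <= i.+1.
  rewrite leqNgt; apply/negP => i_lt.
  apply: (clique_no4 cg (a := x i) (b := x i.+1) (c := x l) (d := x l.+1)) => //.
  rewrite /= !inE !x_inj; move: i_lt; rewrite ?lp;
    by clear; move: i l => i l; lia.
have adj_f j k : x j \in phi f -> x k \in phi f -> j != k -> j <= l.+1 -> k <= l.+1 ->
    adj (x j) (x k).
  by move=> fj fk jk jl kl; apply: cf.2 => //; rewrite x_inj ?lp.
have adj_g j k : x j \in phi g -> x k \in phi g -> j != k -> j <= l.+1 -> k <= l.+1 ->
    adj (x j) (x k).
  by move=> gj gk jk jl kl; apply: cg.2 => //; rewrite x_inj ?lp.
clearbody l; have i_le : i <= l by rewrite -ltnS -lp.
case: l => [|[|[|l]]] in lp x_inj xl e2E gl gl1 l_le adj_f adj_g i_le *.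
- apply: (Meridian1 (e := nth center p 0)); first 2 last.
  + by rewrite -xl; apply: (adj_f 0 1).
  + by case: (p) lp => [|? []].
  + by rewrite edgeE ?lp // xl.
- apply: (Meridian2 (a := x 1) (e1 := nth center p 0) (e2 := nth center p 1)).
  + by case: (p) lp => [|? [|? []]].
  + by rewrite edgeE ?lp.
  + by rewrite edgeE ?lp // xl.
  (* With two edges, the face through both of them makes the poles adjacent: it is [g] if the first
     edge is shared and [f] if the second is. *)
  + rewrite -xl -[n]/(x 0); case: (i) i_le1 fi1 gi => [|[|//]] _ fi1' gi'.
      exact: adj_g.
    exact: adj_f.
  + exact: (adj_f 0 1).
  + by rewrite -xl; apply: adj_g.
(* With three edges the middle one is shared, so [f] contains [x 0], [x 1], [x 2] and [g] contains
   [x 1], [x 2], [x 3]. *)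
- have i1 : i = 1 by apply/eqP; rewrite eqn_leq i_le1.
  rewrite i1 in fi1 gi eE.
  apply: (Meridian3 (a := x 1) (b := x 2) (e := e)) => //.
  + by rewrite eE edgeE ?lp.
  + exact: (adj_f 0 1).
  + exact: (adj_f 0 2).
  + by rewrite -xl; apply: adj_g.
  + by rewrite -xl; apply: adj_g.
  + exact: adj_f.
- by have := leq_ltn_trans l_le (_ : i.+1 < 3); rewrite ltnS => /(_ i_le1).
Qed.
End Oriented.

(* A meridian of length one is covered by [a = c]. *)
Lemma meridian_pair (p q : seq C) n s : n != s ->
  meridian_shape p n s -> meridian_shape q n s ->
  (forall e e' x, e \in p -> e' \in q -> x \in phi e -> x \in phi e' ->
    (x == n) || (x == s)) ->
  (forall e, e \in p -> e \notin q) ->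
  adj n s /\ exists a c,
    [/\ all (fun x => adj n x && adj s x) [:: a; c],
        forall e, (e \in p) || (e \in q) -> phi e \subset [set n; s; a; c]%SET &
        a != c -> forall e, (e \in p) || (e \in q) -> phi e <> [set n; s]%SET].
Proof.
move=> ns Mp Mq disj_v disj_e.
have not3 a b : adj n s ->
    adj n a -> adj n b -> adj s a -> adj s b -> adj a b -> False.
  by move=> ns' na nb sa sb ab; have := no_K4 ns' na nb sa sb; rewrite ab.
have ends_neq a : adj n a -> adj s a -> ([set n; a] <> [set n; s])%SET /\
    ([set a; s] <> [set n; s])%SET.
  move=> na sa; split=> E.
    have : a \in [set n; s]%SET by rewrite -E !inE eqxx orbT.
    by rewrite !inE => /orP[] /eqP ax; move: na sa; rewrite ax !adj_irr.
  have : a \in [set n; s]%SET by rewrite -E !inE eqxx.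
  by rewrite !inE => /orP[] /eqP ax; move: na sa; rewrite ax !adj_irr.
have sub_all (E : seq C) (A : {set ico_vertex}) :
    (forall e, (e \in p) || (e \in q) -> e \in E) ->
    all (fun e => phi e \subset A) E ->
    forall e, (e \in p) || (e \in q) -> phi e \subset A.
  by move=> pqE /allP EA e /pqE /EA.
have pairS x y (A : {set ico_vertex}) :
    ([set x; y] \subset A)%SET = (x \in A) && (y \in A).
  by rewrite finset.subUset !finset.sub1set.
(* Nine pairs of lengths: two single edges would coincide, a length three with a shorter one gives a
   complete graph on four vertices, and two of length three give too many common neighbors of the
   poles. *)
case: Mp => [e pE eE ns'|a e1 e2 pE e1E e2E ns' na sa|a b e pe eE na nb sa sb ab];
case: Mq => [e' qE eE' ns''|c e1' e2' qE e1E' e2E' ns'' nc sc|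
            c d e' qe eE' nc nd sc sd cd].
- have ee' : e = e' by apply: phi_inj; rewrite eE eE'.
  by have := disj_e e; rewrite pE qE ee' !inE eqxx => /(_ isT).
- split=> //; exists c, c; split; rewrite ?eqxx //= ?nc ?sc //.
  apply: (sub_all [:: e; e1'; e2']); first by move=> x; rewrite pE qE !inE.
  by rewrite /= eE e1E' e2E' !pairS !inE !eqxx ?orbT.
- by case: (not3 c d).
- split=> //; exists a, a; split; rewrite ?eqxx //= ?na ?sa //.
  apply: (sub_all [:: e1; e2; e']); first by move=> x; rewrite pE qE !inE orbA.
  by rewrite /= eE' e1E e2E !pairS !inE !eqxx ?orbT.
- split=> //; exists a, c; split; rewrite /= ?na ?sa ?nc ?sc //.
    apply: (sub_all [:: e1; e2; e1'; e2']); first by move=> x; rewrite pE qE !inE -!orbA.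
    by rewrite /= e1E e2E e1E' e2E' !pairS !inE !eqxx ?orbT.
  move=> _ x; rewrite pE qE !inE -!orbA.
  have [na_ns as_ns] := ends_neq a na sa; have [nc_ns cs_ns] := ends_neq c nc sc.
  by case/or4P=> /eqP->; rewrite ?e1E ?e2E ?e1E' ?e2E'.
- by case: (not3 c d).
- by case: (not3 a b).
- by case: (not3 a b).
(* A vertex common to the two middle edges would be a pole, and a pole is not adjacent to itself. *)
- have neq x : x \in phi e -> x \in phi e' -> ~~ adj n x || ~~ adj s x.
    by move=> xe xe'; case/orP: (disj_v e e' x pe qe xe xe') => /eqP->;
      rewrite adj_irr ?orbT.
  have ac : a != c.
    apply/eqP=> ac; have := neq a.
    by rewrite eE eE' ac !inE eqxx nc sc => /(_ isT isT).
  have bc : b != c.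
    apply/eqP=> bc; have := neq b.
    by rewrite eE eE' bc !inE eqxx nc sc orbT => /(_ isT isT).
  have ab' : a != b by apply: contraTneq ab => ->; rewrite adj_irr.
  case: (@three_common_neighbors n s a b c) => //.
    by rewrite /= !inE negb_or ab' ac bc.
  by rewrite /= na sa nb sb nc sc.
Qed.

Lemma adj_neq x y : adj x y -> x != y.
Proof. by apply: contraTneq => ->; rewrite adj_irr. Qed.

Lemma triangle_cell x y z : adj x y -> adj x z -> adj y z ->
  exists2 f, cell_dim f = 2 & phi f = [set x; y; z]%SET.
Proof.
move=> xy xz yz; have cl := clique3 xy xz yz.
have [f fE] := clique_cell cl; exists f => //; apply/eqP.
have := @card_phi f; rewrite clique_noncenter ?fE // => /(_ isT) cardE.
rewrite -eqSS -cardE -finset.setUA cardsU1 cards2 !inE negb_or.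
by rewrite !adj_neq.
Qed.

(** * The hemisphere containing the antipode of the North pole *)

Section Hemispheres.
Variables (p q : seq C) (A : set X) (n s a c : ico_vertex).
Local Notation Z := [set n; s; a; c]%SET.
Local Notation D := (boundary center `\` (path_set p `|` path_set q)).
Hypothesis ns : adj n s.
Hypothesis na : adj n a.
Hypothesis nc : adj n c.
Hypothesis edges_Z : forall e, (e \in p) || (e \in q) -> phi e \subset Z.
Hypothesis A_component : is_component D A.
Hypothesis antipode_A : cell (pt (antipode n)) `<=` A.

(** Keeps the antipode of [n] and its ring of neighbors outside [Z]. *)
Lemma mem_Z x : x \in Z -> (x == n) || adj n x.
Proof.
rewrite !inE -!orbA => /or4P[] /eqP->; rewrite ?eqxx //;
  by rewrite ?ns ?na ?nc orbT.
Qed.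

(** A cell meeting a meridian lies in the closure of a meridian edge, whose vertices belong to
    [Z]. *)
Lemma outer_cell_sub v : v != center -> ~~ (phi v \subset Z) -> cell v `<=` D.
Proof.
move=> vc vZ y vy; split.
  split; first by rewrite center_closure.
  by move=> cy; case/eqP: vc; apply: cell_inj vy cy.
have off r : {subset r <= [pred e | (e \in p) || (e \in q)]} -> ~ path_set r y.
  move=> r_pq /(path_set_cell vy)[e re /phi_sub ve]; case/negP: vZ.
  exact: fintype.subset_trans ve (edges_Z (r_pq e re)).
by case; apply: off => e /= er; rewrite inE er ?orbT.
Qed.

(** The union of two incident cells is connected and avoids the meridians, so it stays in one
    component. *)
Lemma component_incident u v : u != center -> v != center ->
  ~~ (phi u \subset Z) -> ~~ (phi v \subset Z) -> in_closure u v ->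
  cell u `<=` A <-> cell v `<=` A.
Proof.
move=> uc vc uZ vZ uv.
have absorb y : (cell u `|` cell v) y -> A y -> cell u `|` cell v `<=` A.
  apply: component_absorbs A_component (cell_setU_connected uv) _.
  by move=> x [/outer_cell_sub|/outer_cell_sub]; apply.
have [[x ux] [y vy]] := (cell_nonempty u, cell_nonempty v).
split=> sub z zz.
  by apply: (absorb x); [left|exact: sub|right].
by apply: (absorb y); [right|exact: sub|left].
Qed.

Lemma pt_noncenter x : pt x != center.
Proof. by apply: clique_noncenter; rewrite phi_pt; apply: clique1. Qed.

Lemma outer_pt_neighbor x y : adj x y -> x \notin Z -> y \notin Z ->
  cell (pt x) `<=` A -> cell (pt y) `<=` A.
Proof.
move=> xy xZ yZ xA; have [e eE] := clique_cell (clique2 xy).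
have ec : e != center by apply: clique_noncenter; rewrite eE; apply: clique2.
have eZ : ~~ (phi e \subset Z) by rewrite eE finset.subUset !finset.sub1set (negbTE xZ).
have ptZ z : z \notin Z -> ~~ (phi (pt z) \subset Z) by rewrite phi_pt finset.sub1set.
have incident z : z \in phi e -> z \notin Z -> cell (pt z) `<=` A <-> cell e `<=` A.
  move=> ze zZ; apply: component_incident (pt_noncenter z) ec (ptZ z zZ) eZ _.
  exact/pt_in_closure.
apply/(incident y _ yZ); first by rewrite eE !inE eqxx orbT.
by apply/(incident x _ xZ); first by rewrite eE !inE eqxx.
Qed.

Lemma antipode_neighbor_outer x : adj (antipode n) x -> x \notin Z.
Proof.
move=> /adj_antipode/andP[xn nx]; apply/negP => /mem_Z.
by rewrite (negbTE xn) (negbTE nx).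
Qed.

Lemma antipode_outer : antipode n \notin Z.
Proof.
have /andP[mn nm] := antipode_far n.
by apply/negP => /mem_Z; rewrite (negbTE mn) (negbTE nm).
Qed.

(** Membership in [A] spreads along edges from the antipode to its ring, and from there to the
    neighbors of [n] outside [Z]. *)
Lemma outer_pt x : x \notin Z -> cell (pt x) `<=` A.
Proof.
move=> xZ; have ring y : adj (antipode n) y -> cell (pt y) `<=` A.
  move=> my; apply: (outer_pt_neighbor my antipode_outer _ antipode_A).
  exact: antipode_neighbor_outer.
case/or4P: (antipode_dichotomy n x) => [/eqP xn|nx|/eqP->//|/ring//].
  by move: xZ; rewrite xn !inE eqxx.
have [y xy my] := adj_to_antipode_link nx.
apply: (outer_pt_neighbor (x := y)) => //; first by rewrite adj_sym.
  exact: antipode_neighbor_outer.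
exact: ring.
Qed.

Lemma outer_cell v : v != center -> ~~ (phi v \subset Z) -> cell v `<=` A.
Proof.
move=> vc vZ; have /subsetPn[x vx xZ] := vZ.
apply: (component_incident (pt_noncenter x) vc _ vZ _).1 (outer_pt xZ).
  by rewrite phi_pt finset.sub1set.
exact/pt_in_closure.
Qed.

(** Three triangles of a fan at the antipode contain a vertex outside [Z], hence lie in [A]. *)
Lemma three_outer_faces : 3 <= #|faces_in C A|.
Proof.
set m := antipode n.
have [x [y [z [t [uniq_s /= /and5P[mx my mz mt _] xy yz zt]]]]] := adj_fan m.
have [f1 df1 f1E] := triangle_cell mx my xy.
have [f2 df2 f2E] := triangle_cell my mz yz.
have [f3 df3 f3E] := triangle_cell mz mt zt.
have faceA f : cell_dim f = 2 -> m \in phi f -> f \in faces_in C A.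
  move=> f2' mf; rewrite inE f2' eqxx; apply/asboolP; apply: outer_cell.
    by apply: dim_noncenter; rewrite f2'.
  by apply/subsetPn; exists m => //; apply: antipode_outer.
move: uniq_s; rewrite /= !inE !negb_or => /and4P[/and3P[_ xz xt] /andP[_ yt] _ _].
have [xm ym] : x != m /\ y != m by rewrite !(eq_sym _ m) !adj_neq.
have xNy := adj_neq xy; have yNz := adj_neq yz.
have neq w f g : w \in phi f -> w \notin phi g -> f != g.
  by move=> wf; apply: contraNneq => <-.
have f12 : f1 != f2.
  by apply: (neq x); rewrite ?f1E ?f2E !inE ?eqxx ?orbT // !negb_or xm xNy xz.
have f13 : f1 != f3.
  by apply: (neq x); rewrite ?f1E ?f3E !inE ?eqxx ?orbT // !negb_or xm xz xt.
have f23 : f2 != f3.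
  by apply: (neq y); rewrite ?f2E ?f3E !inE ?eqxx ?orbT // !negb_or ym yNz yt.
have : #|[set f1; f2; f3]%SET| = 3.
  by rewrite -finset.setUA cardsU1 cards2 !inE negb_or f12 f13 f23.
move=> <-; apply: subset_leq_card; rewrite !finset.subUset !finset.sub1set.
by rewrite !faceA // ?f1E ?f2E ?f3E !inE eqxx.
Qed.

Lemma other_hemisphere_faces (B : set X) f : A `&` B = set0 -> cell_dim f = 2 ->
  cell f `<=` B -> phi f \subset Z.
Proof.
move=> AB0 f2 fB; apply: contraT => fZ; have [y fy] := cell_nonempty f.
have fA : cell f `<=` A by apply: outer_cell => //; apply: dim_noncenter; rewrite f2.
by have : (A `&` B) y; [split; [apply: fA|apply: fB]|rewrite AB0].
Qed.
End Hemispheres.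

(** If distinct, [a] and [c] are not adjacent by [no_K4], so a triangle contains at most one of
    them. *)
Lemma inner_face n s a c f : adj n s -> adj n a -> adj s a -> adj n c -> adj s c ->
  cell_dim f = 2 -> phi f \subset [set n; s; a; c]%SET ->
  phi f = [set n; s; a]%SET \/ phi f = [set n; s; c]%SET.
Proof.
move=> ns na sa nc sc f2 fZ; have cf := face_clique f2.
have card_f : #|phi f| = 3 by rewrite card_phi ?f2 // dim_noncenter ?f2.
have triangle b : phi f \subset [set n; s; b]%SET -> phi f = [set n; s; b]%SET.
  move=> sub; apply/eqP; rewrite eqEcard sub card_f.
  by rewrite -finset.setUA cardsU1 cards2; case: (_ \notin _); case: (_ != _).
have [fc|fNc] := boolP (c \in phi f); last first.
  left; apply: triangle; apply/fintype.subsetP => x fx.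
  have := fintype.subsetP fZ x fx; rewrite !inE => /orP[//|/eqP xc].
  by rewrite -xc fx in fNc.
right; apply: triangle; apply/fintype.subsetP => x fx.
have := fintype.subsetP fZ x fx; rewrite !inE -!orbA => /or4P[->//|->|/eqP xa|->];
  rewrite ?orbT //.
have [ac|ac] := eqVneq a c; first by rewrite xa ac eqxx !orbT.
by have := no_K4 ns na nc sa sc; rewrite cf.2 // -xa.
Qed.
End IcosahedralComplex.

(** * Poles and face counts of a Sturm icosahedron *)

Lemma dpath_dim (R : realType) (X : topologicalType) (C : regular_cw R X)
    (o : orientation C) p (u v e : C) : dpath o u p v -> e \in p -> cell_dim e = 1.
Proof.
elim: p u => //= e' p IHp u /and3P[/eqP e'1 _ path_p].
by rewrite inE => /predU1P[->//|]; apply: IHp path_p.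
Qed.

Theorem theorem7p1 (R : realType) (X : topologicalType) (C : regular_cw R X)
    (T : template C) (hico : solid_icosahedron C) :
  edge_neighbors (tN T) (tS T) /\
  (face_count_eta T <= 2)%N /\
  ((#|faces_in C (tW T)| <= #|faces_in C (tE T)|)%N -> face_count_eta T = 2%N ->
   exists f g : C,
     f != g /\ faces_in C (tW T) = [set f; g]%SET /\
     exists e : C,
       unique (shared_nonmeridian_edge T f g) e /\
       edge_ends e (tN T) (tS T)).
Proof.
have [phi [phi_inj phi_face phi_sub]] := hico.
have center_dim := tcenter_dim T; have center_closure := tcenter_closure T.
pose pt := pt phi_face.
have dim0 v : cell_dim v = 0 -> exists x, v = pt x.
  exact: (dim0_pt phi_inj phi_face phi_sub center_dim center_closure).
have [acyc src snk] := tbipolar T.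
have [n nE] := dim0 _ ((src _).2 erefl).1.
have [s sE] := dim0 _ ((snk _).2 erefl).1.
have [W_comp E_comp WE0 WED] := themispheres T.
set p := tWE T in W_comp E_comp WED *; set q := tEW T in W_comp E_comp WED *.
have p_path : dpath (torient T) (pt n) p (pt s) by rewrite -nE -sE; apply: tWE_path.
have q_path : dpath (torient T) (pt n) q (pt s) by rewrite -nE -sE; apply: tEW_path.
have [e1 e1p [[f_dim _ e1f] _]] := tNE_unique T.
have [e2 e2p [[g_dim _ e2g] _]] := tSW_unique T.
have [e1' e1q [[f_dim' _ e1f'] _]] := tNW_unique T.
have [e2' e2q [[g_dim' _ e2g'] _]] := tSE_unique T.
have p_shape : meridian_shape phi p n s.
  exact: (meridianP phi_inj phi_sub center_dim center_closure acyc
           p_path e1p e2p f_dim g_dim e1f e2g (tNE_SW T)).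
have q_shape : meridian_shape phi q n s.
  exact: (meridianP phi_inj phi_sub center_dim center_closure acyc
           q_path e1q e2q f_dim' g_dim' e1f' e2g' (tNW_SE T)).
(* Equal poles would turn the nonempty path [p] into a directed cycle. *)
have neq_ns : n != s.
  apply/eqP => eq_ns; rewrite -eq_ns in p_path.
  by have [p' pE] := e1p; have := acyc _ _ p_path; rewrite /p pE.
have poles_only v y : cell v y -> path_set p y -> path_set q y -> v = pt n \/ v = pt s.
  move=> vy py qy; have : (path_set p `&` path_set q) y by [].
  by rewrite tmeridians_disjoint nE sE => -[] /(cell_inj vy); [left|right].
have disj_v e e' x : e \in p -> e' \in q -> x \in phi e -> x \in phi e' ->
    (x == n) || (x == s).
  move=> pe qe ex ex'; have [y xy] := cell_nonempty (pt x).
  have ptE z : pt x = pt z -> x == z by move=> /(pt_inj (phi_face := phi_face))/eqP.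
  case: (poles_only (pt x) y xy) => [||/ptE->//|/ptE->]; rewrite ?orbT //.
    by exists e => //; move: y xy; apply/pt_in_closure.
  by exists e' => //; move: y xy; apply/pt_in_closure.
(* An edge on both meridians would be a pole, of dimension 0. *)
have disj_e e : e \in p -> e \notin q.
  move=> pe; apply/negP => qe; have [y ey] := cell_nonempty e.
  have cly : closure (cell e) y by apply: subset_closure.
  have := dpath_dim p_path pe.
  have [||->|->] := poles_only e y ey; try by exists e.
    by rewrite -nE ((src _).2 erefl).1.
  by rewrite -sE ((snk _).2 erefl).1.
have [ns [a [c [/and3P[/andP[na sa] /andP[nc sc] _] edges_Z ac_edges]]]] :=
  meridian_pair phi_inj neq_ns p_shape q_shape disj_v disj_e.
have [fa fa2 faE] :=
  triangle_cell phi_inj phi_face phi_sub center_dim center_closure ns na sa.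
have [fc fc2 fcE] :=
  triangle_cell phi_inj phi_face phi_sub center_dim center_closure ns nc sc.
have [e eE] := clique_cell phi_face (clique2 ns).
have dimE v : v != tcenter T -> #|phi v| = (cell_dim v).+1.
  exact: (card_phi phi_inj phi_face phi_sub center_dim center_closure).
have e_nc : e != tcenter T.
  apply: (clique_noncenter phi_face phi_sub center_closure).
  by rewrite eE; apply: clique2.
have e_dim : cell_dim e = 1.
  by apply/eqP; rewrite -eqSS -(dimE _ e_nc) eE cards2 neq_ns.
have e_ends : edge_ends e (tN T) (tS T).
  split=> //; have [x [y [xE yE xy]]] :=
    oriented_edge phi_inj phi_face phi_sub center_dim center_closure (torient T) e_dim.
  have [neq_xy ->] := orientation_ends (torient T) e_dim.
  rewrite nE sE xE yE; rewrite xE yE in neq_xy.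
  have {neq_xy} : x != y by apply: contraNneq neq_xy => ->.
  have : x \in phi e by rewrite xy !inE eqxx.
  have : y \in phi e by rewrite xy !inE eqxx orbT.
  rewrite eE !inE => /orP[] /eqP-> /orP[] /eqP->; rewrite ?eqxx // => _.
  by rewrite classical_sets.setUC.
have small_side A B :
    is_component (boundary (tcenter T) `\` (path_set p `|` path_set q)) A ->
    cell (pt (antipode n)) `<=` A -> A `&` B = set0 ->
    faces_in C B \subset [set fa; fc]%SET.
  move=> A_comp mA AB0; apply/fintype.subsetP => f.
  rewrite inE => /andP[/eqP f2 /asboolP fB].
  have fZ := other_hemisphere_faces phi_sub center_dim center_closure ns na nc edges_Z
    A_comp mA AB0 f2 fB.
  have [fE|fE] := inner_face phi_inj phi_face phi_sub center_dim center_closure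
    ns na sa nc sc f2 fZ.
    by rewrite !inE (phi_inj f fa) ?eqxx // faE.
  by rewrite !inE (phi_inj f fc) ?eqxx ?orbT // fcE.
have le2 B : faces_in C B \subset [set fa; fc]%SET -> #|faces_in C B| <= 2.
  by move=> /subset_leq_card/leq_trans; apply; rewrite cards2; case: (_ != _).
have big_side A : is_component (boundary (tcenter T) `\` (path_set p `|` path_set q)) A ->
    cell (pt (antipode n)) `<=` A -> 2 < #|faces_in C A|.
  exact: (three_outer_faces phi_inj phi_sub center_dim center_closure ns na nc edges_Z).
(* The hemisphere containing the antipode has at least three faces, the other at most the two faces
   [fa] and [fc]. *)
have [mW|mE] : cell (pt (antipode n)) `<=` tW T \/ cell (pt (antipode n)) `<=` tE T.
  have mD := outer_cell_sub phi_sub center_closure edges_Z.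
  have {}mD : cell (pt (antipode n)) `<=`
      boundary (tcenter T) `\` (path_set p `|` path_set q).
    apply: mD; first exact: (pt_noncenter phi_face phi_sub center_closure).
    by rewrite phi_pt finset.sub1set; apply: antipode_outer.
  have [y my] := cell_nonempty (pt (antipode n)).
  have m_conn : connected (cell (pt (antipode n))).
    have := cell_setU_connected (@in_closure_refl _ _ _ (pt (antipode n))).
    by rewrite classical_sets.setUid.
  have := mD y my; rewrite -WED => -[Wy|Ey]; [left|right].
    exact: component_absorbs W_comp m_conn mD my Wy.
  exact: component_absorbs E_comp m_conn mD my Ey.
- have E_small := small_side _ _ W_comp mW WE0.
  split; last split.
  + split; last by exists e.
    by rewrite nE sE; apply: contraNneq neq_ns => /(pt_inj (phi_face := phi_face))->.
  + by rewrite /face_count_eta geq_min; apply/orP; right; apply: le2.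
  (* Here West is strictly larger, against the convention [W_le]. *)
  + by move=> W_le; have := leq_trans (big_side _ W_comp mW)
      (leq_trans W_le (le2 _ E_small)).
have EW0 : tE T `&` tW T = set0 by rewrite classical_sets.setIC.
have W_small := small_side _ _ E_comp mE EW0.
split; last split.
- split; last by exists e.
  by rewrite nE sE; apply: contraNneq neq_ns => /(pt_inj (phi_face := phi_face))->.
- by rewrite /face_count_eta geq_min le2.
move=> W_le; rewrite /face_count_eta (minn_idPl W_le) => W2.
have neq_f : fa != fc.
  have := subset_leq_card W_small; rewrite W2 cards2; by case: (_ != _).
exists fa, fc; split=> //; split.
  by apply/eqP; rewrite eqEcard W_small W2 cards2 neq_f.
(* Two Western faces force [a != c], and then [ac_edges] keeps the edge between the poles off both
   meridians. *)
have neq_ac : a != c.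
  by apply: contraNneq neq_f => ac; apply/eqP/phi_inj; rewrite faE fcE ac.
exists e; split=> //; split.
  have off r : (forall x, x \in r -> (x \in p) || (x \in q)) -> e \notin r.
    by move=> rpq; apply/negP => /rpq /(ac_edges neq_ac).
  split=> //; first by apply/phi_sub; rewrite eE faE finset.subsetUl.
  - by apply/phi_sub; rewrite eE fcE finset.subsetUl.
  - by apply: off => x ->.
  - by apply: off => x ->; rewrite orbT.
(* Uniqueness: since [a != c], the two triangles have only the vertices [n] and [s] in common. *)
move=> e' [e'_dim /phi_sub e'a /phi_sub e'c _ _]; apply: phi_inj.
apply/esym/eqP; rewrite eqEcard eE cards2 neq_ns dimE ?e'_dim ?andbT; last first.
  by apply: (dim_noncenter center_dim); rewrite e'_dim.
apply/fintype.subsetP => x xe'.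
move: (fintype.subsetP e'a x xe') (fintype.subsetP e'c x xe').
rewrite faE fcE !inE => /orP[//|/eqP->] /orP[//|].
by rewrite (negbTE neq_ac).
Qed.
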